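(* Let $G$ be a finite, simple, connected bipartite graph with bipartition $(U,W)$, not isomorphic to $K_2$. If there exists a vertex $v$ such that $d_G(v)\notin\{d_G(x): x\in N(v)\}$ and the graph $G-v-N(v)$ (obtained by deleting $v$ and all its neighbors) is connected, then $G$ admits a vertex-coloring $2$-edge-weighting.
   Context: A $k$-edge-weighting of $G$ is a map $w:E(G)\to\{1,\dots,k\}$; it induces the vertex coloring $c(u)=\sum_{e\ni u} w(e)$ for $u\in V(G)$. The edge-weighting is vertex-coloring if $c(u)\ne c(v)$ for every edge $uv\in E(G)$. $N(v)$ denotes the set of neighbors of $v$ and $d_G(v)$ its degree. *)

(* Defs.v *)
From mathcomp Require Import all_boot.

Set Implicit Arguments.
Unset Strict Implicit.
Unset Printing Implicit Defensive.

Record sgraph := SGraph {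
  vertex :> finType;
  adj : rel vertex;
  adj_sym : symmetric adj;
  adj_irrefl : irreflexive adj
}.

Definition edges (G : sgraph) : {set {set G}} :=
  [set [set p.1; p.2] | p in [set p : G * G | adj p.1 p.2]].

Definition neighbors (G : sgraph) (v : G) : {set G} := [set x | adj v x].

Definition degree (G : sgraph) (v : G) : nat := #|neighbors v|.

(* The graph without vertices counts as connected. *)
Definition connected (G : sgraph) : Prop :=
  forall x y : G, connect (@adj G) x y.

Definition is_bipartition (G : sgraph) (U W : {set G}) : Prop :=
  [/\ U :|: W = [set: G], [disjoint U & W] &
      forall x y : G, adj x y ->
        (x \in U /\ y \in W) \/ (x \in W /\ y \in U)].

Definition isomorphic (G H : sgraph) : Prop :=
  exists2 f : G -> H, bijective f & forall x y, adj (f x) (f y) = adj x y.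

Section Induced.
Variables (G : sgraph) (A : {set G}).

Definition induced_adj : rel {x : G | x \in A} :=
  fun x y => adj (val x) (val y).

Lemma induced_adj_sym : symmetric induced_adj.
Proof. by move=> x y; apply: adj_sym. Qed.

Lemma induced_adj_irrefl : irreflexive induced_adj.
Proof. by move=> x; apply: adj_irrefl. Qed.

Definition induced : sgraph := SGraph induced_adj_sym induced_adj_irrefl.
End Induced.

Section Complete.
Variable n : nat.

Definition complete_adj : rel 'I_n := fun i j => i != j.

Lemma complete_adj_sym : symmetric complete_adj.
Proof. by move=> i j; apply: (congr1 negb (eq_sym i j)). Qed.

Lemma complete_adj_irrefl : irreflexive complete_adj.
Proof. by move=> i; rewrite /complete_adj eqxx. Qed.

Definition complete_graph : sgraph :=
  SGraph complete_adj_sym complete_adj_irrefl.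
End Complete.

Definition delete (G : sgraph) (A : {set G}) : sgraph := induced (~: A).

(* Only the values of [w] on [edges G] matter. *)
Definition edge_weighting (G : sgraph) (k : nat) (w : {set G} -> nat) : Prop :=
  forall f : {set G}, f \in edges G -> 1 <= w f <= k.

Definition vertex_color (G : sgraph) (w : {set G} -> nat) (u : G) : nat :=
  \sum_(f in edges G | u \in f) w f.

Definition vertex_coloring (G : sgraph) (w : {set G} -> nat) : Prop :=
  forall u v : G, adj u v -> vertex_color w u <> vertex_color w v.

(* Main.v *)
Require Import Defs.
From mathcomp Require Import all_boot.

(** Using weights 1 and 2, the parity of a vertex color is the parity of the
    number of incident edges of weight 1.  In a connected graph every vertex
    set [T] of even size is the set of odd-degree vertices of some edge set
    (add up, modulo 2, paths pairing the elements of [T]), so any even set [T]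
    can be made the set of vertices of odd color.  Let [v] lie in [U].
    If [#|U|] is even, take [T = U]: edges join odd colors to even ones.
    If [#|U|] is odd, give weight 2 to every edge meeting [v |: N(v)], and take
    [T = U :\ v] inside the connected graph [G - v - N(v)].  Edges not at [v]
    are fine by parity, and an edge [vx] has end colors
    [2 d(v) <> 2 d(x)]. *)

Set Implicit Arguments.
Unset Strict Implicit.
Unset Printing Implicit Defensive.

Section Joins.
Variable G : sgraph.
Implicit Types (x y z : G) (A T : {set G}) (b : {set G} -> bool).

(** The degree of [z] modulo 2 in the edge set with indicator [b]; with Boolean indicators,
    symmetric difference is pointwise [addb]. *)
Definition incident_parity b z : bool :=
  \big[addb/false]_(f in edges G | z \in f) b f.

Lemma edgesP (f : {set G}) :
  reflect (exists x y, adj x y /\ f = [set x; y]) (f \in edges G).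
Proof.
apply: (iffP imsetP) => [[[x y]]|[x [y [xy ->]]]].
  by rewrite inE /= => xy ->; exists x, y.
by exists (x, y); rewrite ?inE.
Qed.

Lemma card_incident_edges x : #|[set f in edges G | x \in f]| = degree x.
Proof.
have -> : [set f in edges G | x \in f] = [set [set x; y] | y in neighbors x].
  apply/setP => f; rewrite inE; apply/andP/imsetP => [[]|[y]].
    case/edgesP => y [z [yz ->]]; rewrite !inE => /orP[]/eqP->.
      by exists z; rewrite ?inE.
    by exists y; rewrite ?inE 1?adj_sym // setUC.
  rewrite inE => xy ->; split; last by rewrite !inE eqxx.
  by apply/edgesP; exists x, y.
(* Injectivity of [y] to [[set x; y]] on neighbors: [y] lies in [[set x; z]] and differs from [x],
   as there are no loops. *)
apply: card_in_imset => y z; rewrite !inE => xy _ /setP/(_ y).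
rewrite !inE eqxx orbT; case: eqP => [yx|_ /esym/eqP //].
by rewrite yx adj_irrefl in xy.
Qed.

(** This is a [T]-join using only edges inside [A]. *)
Definition parity_join A T b : Prop :=
  (forall f, b f -> f \subset A) /\
  forall z, incident_parity b z = (z \in T).

Definition adj_in A : rel G := fun x y => [&& adj x y, x \in A & y \in A].

Lemma incident_parityD b1 b2 z :
  incident_parity (fun f => b1 f (+) b2 f) z =
  incident_parity b1 z (+) incident_parity b2 z.
Proof. exact: big_split. Qed.

Lemma incident_parity0 z : incident_parity (fun=> false) z = false.
Proof. exact: big1. Qed.

Lemma incident_parity_edge x y z : adj x y ->
  incident_parity (pred1 [set x; y]) z = (z == x) (+) (z == y).
Proof.
move=> xy; have xNy : x != y.
  by apply: contraTneq xy => ->; rewrite adj_irrefl.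
have -> : (z == x) (+) (z == y) = (z \in [set x; y]).
  by rewrite !inE; case: eqP => // ->; rewrite (negPf xNy).
rewrite /incident_parity; case zin: (z \in _).
  have xyE : [set x; y] \in edges G by apply/edgesP; exists x, y.
  rewrite (bigD1 [set x; y]) ?xyE //= eqxx big1 // => f.
  by case/andP=> _ /negPf.
rewrite big1 //= => f /andP[_ zf].
by apply: contraTF zf => /eqP->; rewrite zin.
Qed.

(** Add the edges of a walk modulo 2: each inner vertex is counted twice and cancels. Repeated edges
    cancel too, so the walk need not be simple. *)
Lemma connect_join A x y : connect (adj_in A) x y ->
  exists b, (forall f, b f -> f \subset A) /\
    forall z, incident_parity b z = (z == x) (+) (z == y).
Proof.
case/connectP => p; elim: p x => [|u p IH] x /=.
  move=> _ ->; exists (fun=> false); split=> // z.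
  by rewrite incident_parity0 addbb.
case/andP => /and3P[xu xA uA] /IH{}IH /IH [b [bA bP]].
exists (fun f => pred1 [set x; u] f (+) b f); split=> [f /=|z].
  case: eqP => [-> _|_ /bA //].
  by apply/subsetP => t; rewrite !inE => /orP[]/eqP->.
by rewrite incident_parityD incident_parity_edge // bP addbA addbK.
Qed.

(** Induction on the size of [T]: remove two elements [x] and [y], then add to a join of the rest a
    walk between them. *)
Lemma even_set_join A T :
    {in A &, forall x y, connect (adj_in A) x y} ->
    T \subset A -> ~~ odd #|T| ->
  exists b, parity_join A T b.
Proof.
move=> connA; have [n] := ubnP #|T|; elim: n T => // n IH T ltTn TA Teven.
have [->|[x xT]] := set_0Vmem T.
  by exists (fun=> false); split=> // z; rewrite incident_parity0 inE.
have Tx := cardsD1 x T; rewrite xT in Tx.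
have [T0|[y yT]] := set_0Vmem (T :\ x).
  by move: Teven; rewrite Tx T0 cards0.
have Ty := cardsD1 y (T :\ x); rewrite yT in Ty.
have TT : #|T| = #|T :\ x :\ y|.+2 by rewrite Tx Ty.
have [|||b1 [b1A b1P]] := IH (T :\ x :\ y).
- by move: ltTn; rewrite TT ltnS; apply: leq_trans.
- by apply: subset_trans TA; apply: subset_trans (subsetDl _ _) (subsetDl _ _).
- by move: Teven; rewrite TT /= negbK.
have [yNx {}yT] : y != x /\ y \in T by move: yT; rewrite !inE => /andP.
have [b2 [b2A b2P]] :=
  connect_join (connA _ _ (subsetP TA x xT) (subsetP TA y yT)).
exists (fun f => b1 f (+) b2 f); split=> [f|z].
  case b1f: (b1 f) => /=; [by move=> _; exact: b1A | exact: b2A].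
rewrite incident_parityD b1P b2P !inE.
have [->|zx] := eqVneq z x; first by rewrite eq_sym (negPf yNx) xT.
by have [->|zy] /= := eqVneq z y; rewrite ?yT // addbF.
Qed.

Definition join_weight b (f : {set G}) : nat := if b f then 1 else 2.

Lemma join_weighting b : edge_weighting 2 (join_weight b).
Proof. by move=> f _; rewrite /join_weight; case: (b f). Qed.

Lemma odd_join_color b z :
  odd (vertex_color (join_weight b) z) = incident_parity b z.
Proof.
rewrite /vertex_color (big_morph odd oddD (erefl _)).
by apply: eq_bigr => f _; rewrite /join_weight; case: (b f).
Qed.

(** No edge at [z] lies inside [A], so each of them has weight 2. *)
Lemma join_color_outside A b z : (forall f, b f -> f \subset A) -> z \notin A ->
  vertex_color (join_weight b) z = degree z * 2.
Proof.
move=> bA zA; rewrite -card_incident_edges -sum_nat_const /vertex_color.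
apply: eq_big => [f|f /andP[_ zf]]; first by rewrite inE.
rewrite /join_weight; case: ifP => // /bA/subsetP/(_ z zf).
by rewrite (negPf zA).
Qed.

Lemma connected_induced A : connected (induced A) ->
  {in A &, forall x y, connect (adj_in A) x y}.
Proof.
move=> connA x y xA yA.
have /connectP[p] := connA (exist _ x xA : induced A) (exist _ y yA).
(* Both endpoints are written as [val] of subtype elements so that the induction can follow the path
   in [induced A]. *)
rewrite -[x]/(val (exist _ x xA : induced A)).
rewrite -[y in connect _ _ y]/(val (exist _ y yA : induced A)) => pp ->.
elim: p (exist _ x xA : induced A) pp => [|u p IH] t //= /andP[tu pp].
apply: connect_trans (IH u pp); apply: connect1.
by rewrite /adj_in (valP t) (valP u) !andbT.
Qed.

Lemma is_bipartition_sym (U W : {set G}) :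
  is_bipartition U W -> is_bipartition W U.
Proof.
case=> UW dUW bip; split; [by rewrite setUC | by rewrite disjoint_sym |].
by move=> x y /bip[]; [right | left].
Qed.

Lemma vertex_coloring_bipartite (U W : {set G}) (w : {set G} -> nat) :
    is_bipartition U W ->
    (forall x y, adj x y -> x \in U -> y \in W ->
      vertex_color w x <> vertex_color w y) ->
  vertex_coloring w.
Proof.
case=> _ _ bip col x y xy; case: (bip _ _ xy) => [[xU yW]|[xW yU]].
  exact: col.
by apply/nesym; apply: col; rewrite 1?adj_sym.
Qed.

Lemma bipartite_weighting (U W : {set G}) v :
    connected G -> is_bipartition U W -> v \in U ->
    (forall x, x \in neighbors v -> degree v <> degree x) ->
    connected (delete (v |: neighbors v)) ->
  exists w : {set G} -> nat, edge_weighting 2 w /\ vertex_coloring w.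
Proof.
move=> connG bipUW vU degv connA.
have [_ dUW bip] := bipUW.
have WU y : y \in W -> (y \in U) = false.
  by move=> yW; rewrite (disjointFl dUW).
case: (boolP (odd #|U|)) => [Uodd|Ueven].
  set A := ~: (v |: neighbors v).
  (* Since [v] is in [U], all its neighbors lie in [W]. *)
  have UA : U :\ v \subset A.
    apply/subsetP => x; rewrite !inE => /andP[/negPf-> xU] /=.
    apply/negP => /bip[[_ /WU]|[/WU]]; first by rewrite xU.
    by rewrite vU.
  have [|b [bA bP]] := even_set_join (connected_induced connA) UA.
    by move: Uodd; rewrite (cardsD1 v) vU.
  exists (join_weight b); split; first exact: join_weighting.
  apply: (vertex_coloring_bipartite bipUW) => x y xy xU yW.
  (* If [x] is [v], both ends are outside [A] and their colors are twice their degrees; otherwise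
     [x] has odd color and [y] even color. *)
  have [xv|xv] := eqVneq x v.
    rewrite {}xv in xy *.
    rewrite !(join_color_outside bA) ?inE ?eqxx ?xy ?orbT // => /eqP.
    by rewrite eqn_pmul2r // => /eqP; apply: degv; rewrite inE.
  move=> /(congr1 odd); rewrite !odd_join_color !bP !inE xv xU.
  by rewrite (WU y yW) andbF.
(* With [A] the whole vertex set, [adj_in] is just [adj]. *)
have [|b [bA bP]] := @even_set_join setT U _ (subsetT U) Ueven.
  move=> x y _ _; rewrite (eq_connect (e' := @adj G)); first exact: connG.
  by move=> s t; rewrite /adj_in !inE !andbT.
exists (join_weight b); split; first exact: join_weighting.
apply: (vertex_coloring_bipartite bipUW) => x y xy xU yW.
by move=> /(congr1 odd); rewrite !odd_join_color !bP xU (WU y yW).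
Qed.

End Joins.

Theorem theorem2p6 (G : sgraph) (U W : {set G})
    (hconn : connected G)
    (hbip : is_bipartition U W)
    (hK2 : ~ isomorphic G (complete_graph 2))
    (hv : exists v : G,
        (forall x : G, x \in neighbors v -> degree v <> degree x) /\
        connected (delete (v |: neighbors v))) :
  exists w : {set G} -> nat, edge_weighting 2 w /\ vertex_coloring w.
Proof.
case: hv => v [degv connv]; have [UW _ _] := hbip.
have : v \in U :|: W by rewrite UW inE.
rewrite inE => /orP[vU|vW]; first exact: (bipartite_weighting hconn hbip vU degv connv).
exact: (bipartite_weighting hconn (is_bipartition_sym hbip) vW degv connv).
Qed.
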